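(* Let $T \not\cong B_{n,\Delta}$ be an arbitrary tree on $n$ vertices with maximum vertex degree $\Delta$. Then $c_k(B_{n,\Delta}) \geqslant c_k(T)$ for all $k = 0, 1, \ldots, n$.
   Context: For a simple graph $G$ on $n$ vertices with Laplacian matrix $L(G) = D(G) - A(G)$, the Laplacian coefficients $c_0(G), \ldots, c_n(G)$ are defined by $\det(\lambda I_n - L(G)) = \sum_{k=0}^n (-1)^k c_k(G) \lambda^{n-k}$. The broom $B_{n,\Delta}$ is the tree on $n$ vertices consisting of a star $S_{\Delta+1}$ (on $\Delta+1$ vertices) and a path of length $n - \Delta - 1$ attached to an arbitrary pendent vertex of the star (so $n-\Delta-1$ new vertices are added, extending that pendent vertex into a path). *)

(* Defs.v *)
From HB Require Import structures.
From mathcomp Require Import all_boot all_order all_algebra.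
Set Implicit Arguments.
Unset Strict Implicit.
Unset Printing Implicit Defensive.
Import Order.TTheory GRing.Theory Num.Theory.
Local Open Scope ring_scope.

Record sgraph (V : finType) := SGraph {
  adj : rel V;
  adj_sym : symmetric adj;
  adj_irr : irreflexive adj }.

Definition isomorphic (V W : finType) (G : sgraph V) (H : sgraph W) : Prop :=
  exists2 f : V -> W, bijective f & forall x y, adj H (f x) (f y) = adj G x y.

Definition deg (V : finType) (G : sgraph V) (x : V) : nat :=
  #|[set y | adj G x y]|.

Definition max_degree (V : finType) (G : sgraph V) : nat :=
  (\max_(x : V) deg G x)%N.

Definition connected (V : finType) (G : sgraph V) : Prop :=
  (0 < #|V|)%N /\ forall x y : V, connect (adj G) x y.

(* [ucycle] also accepts the empty sequence and, by symmetry, the two ends of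
   an edge; the cycles of a simple graph are those of length at least 3. *)
Definition acyclic (V : finType) (G : sgraph V) : Prop :=
  forall c : seq V, (2 < size c)%N -> ~ ucycle (adj G) c.

Definition is_tree (V : finType) (G : sgraph V) : Prop :=
  connected G /\ acyclic G.

Definition adjacency_mx n (G : sgraph 'I_n) : 'M[int]_n :=
  \matrix_(i, j) (adj G i j)%:R.

Definition degree_mx n (G : sgraph 'I_n) : 'M[int]_n :=
  diag_mx (\row_i (deg G i)%:R).

Definition laplacian n (G : sgraph 'I_n) : 'M[int]_n :=
  degree_mx G - adjacency_mx G.

(* Only meaningful for k <= n, because n - k is truncated; see
   [char_poly_laplacian] for the defining expansion. *)
Definition laplacian_coef n (G : sgraph 'I_n) (k : nat) : int :=
  (-1) ^+ k * (char_poly (laplacian G))`_(n - k).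

Lemma char_poly_laplacian n (G : sgraph 'I_n) :
  char_poly (laplacian G) =
  \sum_(k < n.+1) ((-1) ^+ k * laplacian_coef G k) *: 'X^(n - k).
Proof.
rewrite -[LHS]coefK size_char_poly poly_def (reindex_inj rev_ord_inj) /=.
by apply: eq_bigr => k _; rewrite subSS /laplacian_coef signrMK.
Qed.

(* Vertex 0 is the centre of the star, 1, ..., Delta are its neighbours, and
   the path Delta, Delta + 1, ..., n - 1 extends the neighbour Delta.  This is
   the broom for Delta < n, with 0 < Delta unless n = 1. *)
Definition broom_arc (Delta i j : nat) : bool :=
  ((i == 0) && (0 < j <= Delta) || (Delta <= i) && (j == i.+1))%N.

Definition broom_adj (n Delta : nat) : rel 'I_n :=
  fun i j => broom_arc Delta i j || broom_arc Delta j i.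

Lemma broom_adj_sym n Delta : symmetric (@broom_adj n Delta).
Proof. by move=> i j; rewrite /broom_adj orbC. Qed.

Lemma broom_adj_irr n Delta : irreflexive (@broom_adj n Delta).
Proof.
move=> i; rewrite /broom_adj orbb /broom_arc (ltn_eqF (ltnSn i)) andbF orbF.
by case: (val i).
Qed.

Definition broom (n Delta : nat) : sgraph 'I_n :=
  SGraph (@broom_adj_sym n Delta) (@broom_adj_irr n Delta).

(* Main.v *)
Require Import Defs.
From mathcomp Require Import all_boot all_order all_algebra.
From mathcomp Require Import ring zify.
Import Order.TTheory GRing.Theory Num.Theory.
Local Open Scope ring_scope.
Set Implicit Arguments.
Unset Strict Implicit.
Unset Printing Implicit Defensive.

(** Since det(x - L) = x^n det(1 - L/x), the coefficients c_k of a graph with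
    Laplacian L are those of the polynomial det(1 + X L), called [lap_poly L].
    For a tree this polynomial counts the matchings of the subdivided tree, and
    the proof runs along that interpretation without stating it: only the
    recursion it suggests is needed.

    Let a be [lap_poly] and let b, called [minor_poly], be the principal minor
    of 1 + X L at a root u.  If two disjoint graphs with root data (a, b) and (a', b')
    are joined by an edge between their roots and the first root is kept, then
    (lemmas [lap_poly_join] and [minor_poly_join])

      a'' = a (a' + X b') + X b a',    b'' = b (a' + X b').

    Every tree, with any of its vertices as root, is obtained from single
    vertices by such joins ([tree_is_rooted]), so that these polynomials have
    nonnegative coefficients and can be compared coefficientwise.

    Let f_m be the matching polynomial of the path on m vertices
    ([path_match m]).  Since f_(m + k) = f_m f_k + X f_(m-1) f_(k-1), the
    recursion gives at once a <= f_(2m-1) and b <= f_(2m-2) for every tree on m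
    vertices and every root ([rooted_tree_le_path]): the path rooted at an end
    is the largest.  Now root the tree at a vertex of degree Delta.  Neither
    replacing a branch by a path nor moving all but one vertex of one path
    branch to the end of another ([broom_match_shift]) decreases a or b.
    The second claim reduces to
    f_(2m+2) f_(2k+2) <= f_2 f_(2m+2k+2) ([path_match_unbalance]).  When all
    branches but one are reduced to single vertices, the tree is the broom
    ([rooted_tree_le_broom], [broom_lap_poly]). *)

(** * Laplacian coefficients as coefficients of det(1 + X L) *)

Definition pencil n (L : 'M[int]_n) : 'M[{poly int}]_n :=
  1%:M + 'X *: map_mx polyC L.

Definition lap_poly n (L : 'M[int]_n) : {poly int} := \det (pencil L).

(** When u is the root of a tree, the row and column deleted by this minor leave
    the Laplacians of the branches, each with a loop at its own root. *)
Definition minor_poly n (u : 'I_n) (L : 'M[int]_n) : {poly int} :=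
  (\adj (pencil L)) u u.

Lemma horner_char_poly (F : comNzRingType) n (A : 'M[F]_n) (a : F) :
  (char_poly A).[a] = \det (a%:M - A).
Proof.
rewrite -horner_evalE /char_poly -det_map_mx; congr (\det _).
apply/matrixP=> i j; rewrite !mxE /= raddfB /= raddfMn /= !horner_evalE.
by rewrite hornerX hornerC.
Qed.

(** The variable is inverted in the fraction field of int[X], where
    1 + X L = - X (- 1/X - L), so that det(1 + X L) is the reversed characteristic
    polynomial up to signs. *)
Lemma laplacian_coefE n (G : sgraph 'I_n) k : (k <= n)%N ->
  laplacian_coef G k = (lap_poly (laplacian G))`_k.
Proof.
move=> le_kn; set L := laplacian G; set x : {fraction {poly int}} := tofrac 'X.
have x_neq0 : x != 0 by rewrite tofrac_eq0 polyX_eq0.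
pose f : {rmorphism int -> {fraction {poly int}}} :=
  [the {rmorphism _ -> _} of intr].
have fE c : f c = tofrac c%:P by rewrite /f /= -[c in c%:P]intz !rmorph_int.
have -> : lap_poly L = \sum_(j < n.+1) (char_poly L)`_j *: (- 'X) ^+ (n - j).
  apply/eqP; rewrite -tofrac_eq; apply/eqP.
  rewrite /lap_poly -det_map_mx.
  have -> : map_mx (@tofrac _) (pencil L) = (- x) *: ((- x^-1)%:M - map_mx f L).
    apply/matrixP => i j; rewrite !mxE fE rmorphD rmorphM /= -/x.
    by rewrite rmorphMn rmorph1 mulrBr [- x * (_ *+ _)]mulrnAr mulrNN mulfV //
      mulNr opprK.
  rewrite detZ -horner_char_poly -map_char_poly (@horner_coef_wide _ n.+1); last first.
    by rewrite -(size_char_poly L) size_poly.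
  rewrite [RHS]rmorph_sum mulr_sumr; apply: eq_bigr => j _.
  rewrite coef_map /= fE -mul_polyC rmorphM rmorphXn rmorphN /= -/x.
  rewrite mulrCA; congr (_ * _).
  rewrite -invrN exprVn -expfB_cond //.
  by rewrite oppr_eq0 (negbTE x_neq0) leq_ord.
rewrite coef_sum (bigD1 (inord (n - k))) //= inordK ?ltnS ?leq_subr //.
rewrite subKn // big1 => [|j neq].
  by rewrite addr0 coefZ -scaleN1r exprZn coefZ coefXn eqxx mulr1 mulrC.
rewrite coefZ -scaleN1r exprZn coefZ coefXn; case: eqP => [eqk|];
  last by rewrite !mulr0.
case/eqP: neq; apply/val_inj; rewrite /= inordK ?ltnS ?leq_subr //.
by have := ltn_ord j; lia.
Qed.

(** * Joining two graphs by an edge *)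

(** The matrix determinant lemma in a division-free form: with s = det M and
    y = adj(M) c it is the usual one, but any solution y of M y = s c serves, and
    the convenient one can be guessed.  The bordered matrix [D] times one block
    triangular matrix shows det D = det(M + c r), and times another that
    s det D is the right-hand side. *)
Lemma det_rank1 (R : comNzRingType) n (M : 'M[R]_n) (c y : 'cV_n) (r : 'rV_n) s :
  M *m y = s *: c -> s * \det (M + c *m r) = \det M * (s + (r *m y) 0 0).
Proof.
move=> My; pose D := block_mx M (- c) r (1%:M : 'M_1).
have detD : \det D = \det (M + c *m r).
  have: D *m block_mx 1%:M 0 (- r) 1%:M = block_mx (M + c *m r) (- c) 0 1%:M.
    rewrite mulmx_block !mulmx1 !mulmx0 !add0r mul1mx mulNmx mulmxN opprK.
    by rewrite subrr.
  by move/(congr1 determinant); rewrite det_mulmx det_lblock det_ublock !det1 !mulr1.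
have: D *m block_mx 1%:M y 0 s%:M = block_mx M 0 r (r *m y + s%:M).
  rewrite mulmx_block !mulmx1 !mulmx0 !addr0 mul1mx My mulNmx.
  by rewrite mul_mx_scalar subrr.
move/(congr1 determinant); rewrite det_mulmx det_lblock det_ublock det1 mul1r.
rewrite detD !det_mx11 !mxE eqxx mulr1n => eq_det.
by rewrite mulrC eq_det [s + _]addrC.
Qed.

(** All graphs live on the same vertex set: a vertex outside the graph only adds a
    diagonal entry 1 to 1 + X L and so does not affect its determinant. *)
Definition supported n (A : {set 'I_n}) (L : 'M[int]_n) : Prop :=
  forall i j, L i j != 0 -> (i \in A) && (j \in A).

Definition edge_vec n (u w : 'I_n) : 'cV[int]_n :=
  delta_mx u 0 - delta_mx w 0.

Definition edge_mx n (u w : 'I_n) : 'M[int]_n :=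
  edge_vec u w *m (edge_vec u w)^T.

Lemma pencilD n (L L' : 'M[int]_n) :
  pencil (L + L') = pencil L + 'X *: map_mx polyC L'.
Proof. by rewrite /pencil map_mxD scalerDr addrA. Qed.

Lemma pencil0 n : pencil (0 : 'M_n) = 1%:M.
Proof. by rewrite /pencil map_mx0 scaler0 addr0. Qed.

Lemma lap_poly0 n : lap_poly (0 : 'M_n) = 1.
Proof. by rewrite /lap_poly pencil0 det1. Qed.

Lemma minor_poly0 n u : minor_poly u (0 : 'M_n) = 1.
Proof. by rewrite /minor_poly pencil0 adj1 mxE eqxx. Qed.

(** The constant coefficient is det 1 = 1; this is what allows cancellation of
    these determinants below. *)
Lemma lap_poly_neq0 n (L : 'M[int]_n) : lap_poly L != 0.
Proof.
suff: (lap_poly L).[0] = 1 by apply: contra_eq_neq => ->; rewrite horner0.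
rewrite -horner_evalE /lap_poly -det_map_mx -[RHS](@det1 _ n); congr (\det _).
apply/matrixP=> i j; rewrite !mxE /= horner_evalE hornerD hornerM hornerX mul0r.
by rewrite addr0 hornerMn hornerC.
Qed.

Lemma minor_poly_loop n (u : 'I_n) (L : 'M[int]_n) :
  minor_poly u (L + delta_mx u u) = minor_poly u L.
Proof.
rewrite /minor_poly pencilD !mxE /cofactor; congr (_ * \det _).
by apply/matrixP=> i j; rewrite !mxE [_ == u]eq_sym (negbTE (neq_lift u i)) /= mulr0 addr0.
Qed.

(** A loop at u stands for an edge from u to a grounded vertex, so a + X b is the
    contribution of a branch seen from its parent. *)
Lemma lap_poly_loop n (u : 'I_n) (L : 'M[int]_n) :
  lap_poly (L + delta_mx u u) = lap_poly L + 'X * minor_poly u L.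
Proof.
apply: (mulfI (lap_poly_neq0 L)).
have -> : lap_poly (L + delta_mx u u) =
    \det (pencil L + (delta_mx u 0 : 'cV_n) *m ('X *: delta_mx 0 u)).
  rewrite /lap_poly pencilD; congr (\det (_ + _)).
  by rewrite map_delta_mx -scalemxAr mul_delta_mx.
rewrite {1}/lap_poly (@det_rank1 _ _ _ _ (\adj (pencil L) *m delta_mx u 0)).
  by rewrite -scalemxAl mulmxA -rowE -colE /minor_poly !mxE.
by rewrite mulmxA mul_mx_adj mul_scalar_mx.
Qed.

Lemma supported_eq0 n (A : {set 'I_n}) (L : 'M[int]_n) i j :
  supported A L -> (i \notin A) || (j \notin A) -> L i j = 0.
Proof.
by move=> sA; rewrite -negb_and => notA; apply: contraNeq notA; apply: sA.
Qed.

(** Disjoint supports give L L' = 0, whence the factorization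
    1 + X (L + L') = (1 + X L) (1 + X L'). *)
Lemma pencil_disjoint n (A B : {set 'I_n}) (L L' : 'M[int]_n) :
  supported A L -> supported B L' -> [disjoint A & B] ->
  pencil (L + L') = pencil L *m pencil L'.
Proof.
move=> sA sB dAB.
have LL' : L *m L' = 0.
  apply/matrixP=> i j; rewrite !mxE big1 // => k _.
  have [kA|kA] := boolP (k \in A); last by rewrite (supported_eq0 sA) ?kA ?orbT ?mul0r.
  by rewrite (supported_eq0 sB) ?mulr0 // (disjointFr dAB kA).
rewrite pencilD /pencil mulmxDl !mulmxDr !mulmx1 mul1mx -scalemxAl -scalemxAr.
by rewrite -map_mxM LL' map_mx0 !scaler0 addr0 [RHS]addrAC -!addrA.
Qed.

Lemma pencil_col n (A : {set 'I_n}) (L : 'M[int]_n) u :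
  supported A L -> u \notin A -> pencil L *m delta_mx u 0 = delta_mx u 0 :> 'cV_n.
Proof.
move=> sA uA; rewrite -colE; apply/matrixP=> i j.
by rewrite !mxE (supported_eq0 sA) ?uA ?orbT // mulr0 addr0 ord1 eqxx andbT.
Qed.

Lemma adj_pencil_eq0 n (A : {set 'I_n}) (L : 'M[int]_n) u v :
  supported A L -> u \notin A -> u != v -> (\adj (pencil L)) u v = 0.
Proof.
move=> sA uA neq_uv.
have row_u : delta_mx 0 u *m pencil L = delta_mx 0 u :> 'rV_n.
  rewrite -rowE; apply/matrixP=> i j.
  rewrite !mxE (supported_eq0 sA) ?uA // mulr0 addr0 ord1 eqxx /=.
  by rewrite eq_sym.
have /matrixP/(_ 0 v) := congr1 (mulmx (delta_mx 0 u : 'rV_n)) (mul_mx_adj (pencil L)).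
rewrite mulmxA row_u -!rowE !mxE => ->.
by rewrite (negbTE neq_uv).
Qed.

(** The new edge is a rank one update along c = e_u - e_w.  For the two
    pencils K and K', the equation K K' y = det(K K') c is solved by
    y = det(K') adj(K) e_u - det(K) adj(K') e_w, because K and K' commute and
    each of them fixes the basis vector of the other root.  The cross terms of
    (e_u - e_w)^T y vanish by [adj_pencil_eq0]. *)
Lemma lap_poly_join n (A B : {set 'I_n}) (L L' : 'M[int]_n) u w :
  supported A L -> supported B L' -> [disjoint A & B] -> u \in A -> w \in B ->
  lap_poly (L + L' + edge_mx u w) =
  lap_poly L * lap_poly L' +
  'X * (minor_poly u L * lap_poly L' + lap_poly L * minor_poly w L').
Proof.
move=> sA sB dAB uA wB.
have uB : u \notin B by rewrite (disjointFr dAB).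
have wA : w \notin A by rewrite (disjointFl dAB).
have neq_uw : u != w by apply: contraNneq wA => <-.
have polyM := pencil_disjoint sA sB dAB.
have polyM' : pencil (L + L') = pencil L' *m pencil L.
  by rewrite addrC (pencil_disjoint sB sA) // disjoint_sym.
have lapM : lap_poly (L + L') = lap_poly L * lap_poly L'.
  by rewrite /lap_poly polyM det_mulmx.
pose c : 'cV[{poly int}]_n := delta_mx u 0 - delta_mx w 0.
pose r : 'rV[{poly int}]_n := delta_mx 0 u - delta_mx 0 w.
pose y : 'cV[{poly int}]_n := lap_poly L' *: (\adj (pencil L) *m delta_mx u 0)
  - lap_poly L *: (\adj (pencil L') *m delta_mx w 0).
apply: (mulfI (lap_poly_neq0 (L + L'))).
have -> : lap_poly (L + L' + edge_mx u w) = \det (pencil (L + L') + c *m ('X *: r)).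
  rewrite {1}/lap_poly pencilD; congr (\det (_ + _)).
  rewrite -scalemxAr /edge_mx map_mxM -map_trmx map_mxB !map_delta_mx.
  by rewrite [trmx _]raddfB /= !trmx_delta.
rewrite (@det_rank1 _ _ _ _ y).
  rewrite -/(lap_poly _) lapM; congr (_ * (_ + _)).
  rewrite -scalemxAl mxE; congr (_ * _).
  have neq_wu : w != u by rewrite eq_sym.
  have := adj_pencil_eq0 sB uB neq_uw; have := adj_pencil_eq0 sA wA neq_wu.
  rewrite /r /y /minor_poly.
  move: (\adj (pencil L)) (\adj (pencil L')) => F F' Fwu F'uw.
  by rewrite -!colE mulmxBl -!rowE !mxE Fwu F'uw; ring.
rewrite mulmxBr -!scalemxAr {1}polyM' polyM -!mulmxA.
rewrite (mulmxA (pencil L) (\adj _)) (mulmxA (pencil L') (\adj _)) !mul_mx_adj.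
rewrite !mul_scalar_mx -!scalemxAr (pencil_col sB uB) (pencil_col sA wA).
rewrite !scalerA scalerBr -/(lap_poly L) -/(lap_poly L') -/(lap_poly (L + L')) lapM.
by rewrite [lap_poly L' * _]mulrC.
Qed.

Lemma supportedD n (A : {set 'I_n}) (L L' : 'M[int]_n) :
  supported A L -> supported A L' -> supported A (L + L').
Proof.
move=> sL sL' i j; apply: contraNT => notA.
by rewrite mxE (supported_eq0 sL) ?(supported_eq0 sL') ?addr0 // -negb_and.
Qed.

(** Both minors are read off from [lap_poly_join] with and without a loop at u, as
    a loop adds X times the minor. *)
Lemma minor_poly_join n (A B : {set 'I_n}) (L L' : 'M[int]_n) u w :
  supported A L -> supported B L' -> [disjoint A & B] -> u \in A -> w \in B ->
  minor_poly u (L + L' + edge_mx u w) =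
  minor_poly u L * (lap_poly L' + 'X * minor_poly w L').
Proof.
move=> sA sB dAB uA wB.
have polyX0 : 'X != 0 :> {poly int} by rewrite polyX_eq0.
have sAu : supported A (L + delta_mx u u).
  apply: supportedD => // i j; rewrite mxE.
  by case: (i =P u) => [->|]; case: (j =P u) => [->|]; rewrite ?uA.
apply: (mulfI polyX0); apply: (addrI (lap_poly (L + L' + edge_mx u w))).
rewrite -[in LHS]lap_poly_loop.
have -> : L + L' + edge_mx u w + delta_mx u u = L + delta_mx u u + L' + edge_mx u w.
  by rewrite addrAC [L + L' + _]addrAC.
rewrite (lap_poly_join sAu sB) // (lap_poly_join sA sB) //.
by rewrite minor_poly_loop lap_poly_loop; ring.
Qed.

(** * Laplacians of induced subgraphs *)

Definition induced_adj n (T : sgraph 'I_n) (A : {set 'I_n}) : 'M[int]_n :=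
  \matrix_(i, j) ([&& i \in A, j \in A & adj T i j])%:R.

(** Row sums replace the degrees, which makes the Laplacian additive in the
    adjacency matrix. *)
Definition lap_of n (W : 'M[int]_n) : 'M[int]_n :=
  diag_mx (\row_i \sum_j W i j) - W.

Definition induced_lap n (T : sgraph 'I_n) (A : {set 'I_n}) : 'M[int]_n :=
  lap_of (induced_adj T A).

Lemma lap_ofD n (W W' : 'M[int]_n) : lap_of (W + W') = lap_of W + lap_of W'.
Proof.
rewrite /lap_of addrACA -opprD -raddfD; congr (diag_mx _ - _).
by apply/rowP=> i; rewrite !mxE -big_split; apply: eq_bigr => j _; rewrite mxE.
Qed.

Lemma sum_eqr n (i : 'I_n) : \sum_(j < n) (j == i)%:R = 1 :> int.
Proof.
by rewrite (bigD1 i) //= eqxx big1 ?addr0 // => j /negbTE ->.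
Qed.

Lemma lap_of_edge n (u w : 'I_n) :
  lap_of (delta_mx u w + delta_mx w u) = edge_mx u w.
Proof.
apply/matrixP=> i j; rewrite !mxE big_ord1 !mxE !andbT.
under eq_bigr do rewrite !mxE -!mulnb !natrM.
rewrite big_split -!mulr_sumr !sum_eqr !mulr1 -!mulnb !natrM /=.
have idem (b : bool) : b%:R * b%:R = b%:R :> int by case: b.
have [->|neq_ij] := eqVneq i j.
  by rewrite mulr1n mulrBl !mulrBr !idem; ring.
have off v : (i == v)%:R * (j == v)%:R = 0 :> int.
  case: (i =P v) neq_ij => [->|_ _]; rewrite ?mul0r // eq_sym => /negbTE->.
  by rewrite mulr0.
by rewrite mulr0n mulrBl !mulrBr !off; ring.
Qed.

Lemma induced_lap_supported n (T : sgraph 'I_n) A : supported A (induced_lap T A).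
Proof.
move=> i j; apply: contraNT => notA; rewrite !mxE.
have [iA|iA] := boolP (i \in A); have [jA|jA] := boolP (j \in A).
- by rewrite iA jA in notA.
- rewrite subr0 (_ : i == j = false) //; apply: contraNF jA => /eqP <- //.
- by rewrite big1 ?mul0rn ?subr0 // => l _; rewrite mxE (negbTE iA).
- by rewrite big1 ?mul0rn ?subr0 // => l _; rewrite mxE (negbTE iA).
Qed.

Lemma induced_lapT n (T : sgraph 'I_n) : induced_lap T setT = laplacian T.
Proof.
rewrite /induced_lap /lap_of /laplacian; congr (diag_mx _ - _).
  apply/rowP=> i; rewrite !mxE /deg -sum1_card natr_sum [RHS]big_mkcond /=.
  by apply: eq_bigr => j _; rewrite !mxE !inE; case: (adj T i j).
by apply/matrixP=> i j; rewrite !mxE !inE.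
Qed.

Lemma induced_lap1 n (T : sgraph 'I_n) u : induced_lap T [set u] = 0.
Proof.
rewrite /induced_lap (_ : induced_adj T [set u] = 0); last first.
  apply/matrixP=> i j; rewrite !mxE !inE.
  by case: (i =P u) => [->|//]; case: (j =P u) => [->|//]; rewrite adj_irr.
by apply: (addrI (lap_of 0)); rewrite -lap_ofD !addr0.
Qed.

Lemma induced_lap_join n (T : sgraph 'I_n) (A B : {set 'I_n}) u w :
  [disjoint A & B] -> u \in A -> w \in B ->
  {in A & B, forall x y, adj T x y = (x == u) && (y == w)} ->
  induced_lap T (A :|: B) = induced_lap T A + induced_lap T B + edge_mx u w.
Proof.
move=> dAB uA wB cross; rewrite -lap_of_edge -!lap_ofD; congr lap_of.
have inAB x y : x \in A -> y \in B -> x == y = false.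
  by move=> xA yB; apply: contraTF yB => /eqP <-; rewrite (disjointFr dAB).
apply/matrixP=> i j; rewrite !mxE !inE.
have [iA|iA] := boolP (i \in A); have [jA|jA] := boolP (j \in A) => /=.
- rewrite !(disjointFr dAB) //= (inAB j w) // (inAB i w) // andbF /=.
  by rewrite !addr0.
- rewrite (disjointFr dAB iA) /= (inAB i w) //= !addr0 add0r.
  have [jB|jB] := boolP (j \in B); first by rewrite cross //= addr0.
  by case: (j =P w) jB => [->|]; rewrite ?wB // andbF.
- rewrite (disjointFr dAB jA) andbF /= (inAB j w) // andbF !add0r.
  have [iB|iB] := boolP (i \in B); first by rewrite adj_sym cross //= andbC.
  by case: (i =P w) iB => [->|]; rewrite ?wB.
- have /negbTE -> : i != u by apply: contraNneq iA => ->.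
  have /negbTE -> : j != u by apply: contraNneq jA => ->.
  by rewrite andbF /= add0r !addr0.
Qed.

(** * Every tree is built by joining rooted trees *)

(** [rooted_tree u A L d]: a tree on the vertex set A with root u, Laplacian L and
    d branches at the root.  [Graft] makes a second tree a new branch at the
    root of the first, as in the encoding of ordered trees by binary trees. *)
Inductive rooted_tree n : 'I_n -> {set 'I_n} -> 'M[int]_n -> nat -> Prop :=
| RootOnly u : rooted_tree u [set u] 0 0
| Graft u A L d w B L' d' :
    rooted_tree u A L d -> rooted_tree w B L' d' -> [disjoint A & B] ->
    rooted_tree u (A :|: B) (L + L' + edge_mx u w) d.+1.

Lemma rooted_tree_root n (u : 'I_n) A L d : rooted_tree u A L d -> u \in A.
Proof. by elim=> {u A L d} [u|u A L d w B L' d' _ uA _ _ _]; rewrite !inE ?uA. Qed.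

Lemma supportedW n (A B : {set 'I_n}) (L : 'M[int]_n) :
  A \subset B -> supported A L -> supported B L.
Proof. by move=> /subsetP AB sA i j /sA/andP[/AB-> /AB->]. Qed.

Lemma edge_mx_supported n (A : {set 'I_n}) u w :
  u \in A -> w \in A -> supported A (edge_mx u w).
Proof.
move=> uA wA i j; rewrite !mxE big_ord1 !mxE !andbT.
have end_in v : (v == u)%:R - (v == w)%:R != 0 :> int -> v \in A.
  by case: (v =P u) => [->//|_]; case: (v =P w) => [->//|_]; rewrite subrr eqxx.
by rewrite mulf_eq0 negb_or => /andP[/end_in-> /end_in->].
Qed.

Lemma rooted_tree_supported n (u : 'I_n) A L d :
  rooted_tree u A L d -> supported A L.
Proof.
elim=> {u A L d} [u|u A L d w B L' d' tA sA tB sB _]; first by move=> i j; rewrite mxE eqxx.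
apply: supportedD; first apply: supportedD.
- by apply: supportedW sA; apply: subsetUl.
- by apply: supportedW sB; apply: subsetUr.
- by apply: edge_mx_supported; rewrite inE ?(rooted_tree_root tA)
    ?(rooted_tree_root tB) ?orbT.
Qed.

Lemma rooted_tree_deg n (u : 'I_n) A L d : rooted_tree u A L d -> L u u = d%:R.
Proof.
elim=> {u A L d} [u|u A L d w B L' d' tA IH tB _ dAB]; first by rewrite mxE.
have uB : u \notin B by rewrite (disjointFr dAB (rooted_tree_root tA)).
rewrite 2!mxE IH (supported_eq0 (rooted_tree_supported tB)) ?uB // addr0.
rewrite !mxE big_ord1 !mxE !eqxx /= (_ : u == w = false) ?subr0 ?mulr1 -?natr1 //.
by apply: contraNF uB => /eqP->; apply: rooted_tree_root tB.
Qed.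

Lemma rooted_tree_card n (u : 'I_n) A L d : rooted_tree u A L d -> (d < #|A|)%N.
Proof.
elim=> {u A L d} [u|u A L d w B L' d' tA dA tB dB dAB]; first by rewrite cards1.
by rewrite cardsU disjoint_setI0 // cards0 subn0; lia.
Qed.

(** Leaves can be added anywhere, not only at the root, which is what builds an
    arbitrary tree vertex by vertex. *)
Lemma rooted_tree_leaf n (u : 'I_n) A L d v l :
  rooted_tree u A L d -> v \in A -> l \notin A ->
  exists d', rooted_tree u (A :|: [set l]) (L + edge_mx v l) d'.
Proof.
move=> tA; elim: tA v l => {u A L d} [u|u A L d w B L' d' tA IHA tB IHB dAB] v l.
  rewrite !inE => /eqP-> lu; exists 1%N.
  have := Graft (RootOnly u) (RootOnly l); rewrite addr0; apply.
  by rewrite disjoint_sym disjoints1 inE.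
rewrite !inE negb_or => /orP[vA|vB] /andP[lA lB].
- have [d1 tAl] := IHA _ _ vA lA.
  exists d1.+1; rewrite setUAC (addrAC _ (edge_mx u w)) (addrAC L).
  apply: Graft tAl tB _.
  by rewrite -setI_eq0 setIUl setU_eq0 !setI_eq0 dAB disjoints1.
- have [d1 tBl] := IHB _ _ vB lB.
  exists d.+1; rewrite -setUA addrAC -[L + L' + _]addrA.
  apply: Graft tA tBl _.
  rewrite -setI_eq0 setIUr setU_eq0 !setI_eq0 dAB.
  by rewrite [X in _ && X]disjoint_sym disjoints1.
Qed.

(** A connected vertex set A containing v grows until it is everything: by
    connectivity some l outside A is adjacent to some x in A, and x is the only
    such neighbour, because a second one y would close a cycle through l with a
    simple path from y to x inside A. *)
Lemma tree_is_rooted n (T : sgraph 'I_n) (v : 'I_n) : is_tree T ->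
  exists d, rooted_tree v setT (laplacian T) d.
Proof.
case=> -[_ connT] acT.
pose rA (A : {set 'I_n}) := [rel x y | [&& adj T x y, x \in A & y \in A]].
have rA_sym A : symmetric (rA A) by move=> x y /=; rewrite adj_sym [_ && (y \in A)]andbC.
suff: forall k, (k < n)%N -> exists2 A : {set 'I_n}, #|A| = k.+1 &
   {in A &, forall x y, connect (rA A) x y} /\
   exists d, rooted_tree v A (induced_lap T A) d.
  case: n v T connT acT rA rA_sym => [[//]|n] v T connT acT rA rA_sym.
  move/(_ n (ltnSn n)) => [A cardA [_]].
  rewrite (_ : A = setT) ?induced_lapT //.
  by apply/eqP; rewrite eqEcard subsetT cardsT card_ord cardA /=.
elim=> [_|k IHk lt_kn].
  exists [set v]; first by rewrite cards1.
  split; first by move=> x y /set1P-> /set1P->; apply: connect0.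
  by exists 0%N; rewrite induced_lap1; apply: RootOnly.
have [A cardA [connA [d tA]]] := IHk (ltnW lt_kn).
have vA := rooted_tree_root tA.
have [x xA [l lA adj_xl]] : exists2 x, x \in A & exists2 l, l \notin A & adj T x l.
  case: (boolP [exists x in A, exists l, (l \notin A) && adj T x l]).
    by case/exists_inP=> x xA /existsP[l /andP[lA xl]]; exists x => //; exists l.
  move=> /exists_inPn noedge.
  have [z zA] : exists z, z \notin A.
    apply/existsP; rewrite -negb_forall; apply/negP => /forallP allA.
    have AT : A = setT by apply/setP=> z; rewrite allA inE.
    by move: lt_kn; rewrite -cardA AT cardsT card_ord ltnn.
  have clA : closed (adj T) (mem A).
    apply: intro_closed; first by apply: sym_connect_sym; apply: adj_sym.
    move=> x y xy xA; apply: contraNT (noedge x xA) => yA.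
    by apply/existsP; exists y; rewrite yA.
  by rewrite -(closed_connect clA (connT v z)) vA in zA.
have uniq_nbr : forall y, y \in A -> adj T y l = (y == x).
  move=> y yA; apply/idP/eqP => [adj_yl|-> //]; apply/eqP; apply/negPn/negP => neq_yx.
  have /connectP[q path_q] := connA y x yA xA.
  case/shortenP: path_q => p path_p uniq_p _ x_last.
  have p_neq0 : p != [::] by apply: contraNneq neq_yx => p0; rewrite x_last p0.
  have allA : all (mem A) (y :: p).
    rewrite /= yA /=.
    elim: p y {yA adj_yl neq_yx uniq_p x_last p_neq0} path_p => //= z p IHp y.
    by case/andP=> /and3P[_ _ ->] /IHp.
  have adjp : path (adj T) y p.
    by apply: sub_path path_p => a b /and3P[].
  apply: (acT (l :: y :: p)); first by case: (p) p_neq0.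
  apply/andP; split; last first.
    rewrite cons_uniq uniq_p andbT; apply: contra lA; exact: (allP allA).
  by rewrite /= rcons_path adjp -x_last adj_xl adj_sym adj_yl.
exists (A :|: [set l]).
  by rewrite setUC cardsU1 lA cardA.
have sub_rA : subrel (connect (rA A)) (connect (rA (A :|: [set l]))).
  apply: connect_sub => a b /and3P[ab aA bA]; apply: connect1.
  by rewrite /= ab !inE aA bA.
have conn_l y : y \in A -> connect (rA (A :|: [set l])) y l.
  move=> yA; apply: connect_trans (sub_rA _ _ (connA y x yA xA)) _.
  by apply: connect1; rewrite /= adj_xl !inE xA eqxx orbT.
have sym_rA := sym_connect_sym (rA_sym (A :|: [set l])).
split.
  move=> y z; rewrite !inE => /orP[yA|/eqP->] /orP[zA|/eqP->].
  - exact/sub_rA/connA.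
  - exact: conn_l.
  - by rewrite sym_rA; apply: conn_l.
  - exact: connect0.
have [d' tAl] := rooted_tree_leaf tA xA lA; exists d'.
rewrite (@induced_lap_join _ _ _ _ x l) //.
- by rewrite induced_lap1 addr0.
- by rewrite disjoint_sym disjoints1.
- by rewrite inE.
- by move=> y z yA /set1P->; rewrite uniq_nbr // eqxx andbT.
Qed.

(** * Coefficientwise order and matching polynomials of paths *)

Local Notation nonneg p := (p \is a polyOver (@Num.Def.nneg_num_pred int)).

Definition lecoef (p q : {poly int}) := nonneg (q - p).

Local Notation "p <=c q" := (lecoef p q) (at level 70).

Lemma nonnegX : nonneg ('X : {poly int}).
Proof. exact: polyOverX. Qed.

Lemma lecoefP (p q : {poly int}) : p <=c q -> forall k, p`_k <= q`_k.
Proof. by move/polyOverP=> pq k; move: (pq k); rewrite coefB nnegrE subr_ge0. Qed.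

Lemma lecoef_refl p : p <=c p.
Proof. by rewrite /lecoef subrr rpred0. Qed.

Lemma lecoef_trans q p r : p <=c q -> q <=c r -> p <=c r.
Proof. by move=> pq qr; have := rpredD qr pq; rewrite addrA subrK. Qed.

Lemma nonneg_lecoef p q : nonneg p -> p <=c q -> nonneg q.
Proof. by move=> p0 pq; rewrite -(subrK p q) rpredD. Qed.

Lemma lecoefD p q p' q' : p <=c q -> p' <=c q' -> p + p' <=c q + q'.
Proof. by move=> pq pq'; rewrite /lecoef opprD addrACA rpredD. Qed.

Lemma lecoefM p q p' q' :
  nonneg p -> nonneg p' -> p <=c q -> p' <=c q' -> p * p' <=c q * q'.
Proof.
move=> p0 p0' pq pq'.
have -> : p * p' <=c q * q' = nonneg ((q - p) * q' + p * (q' - p')).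
  by rewrite /lecoef; congr (_ \is a _); ring.
by rewrite rpredD ?rpredM // (nonneg_lecoef p0').
Qed.

(** The coefficient of X^j is the number of j-edge matchings of the path on m
    vertices. *)
Fixpoint path_match m : {poly int} :=
  if m is m1.+1 then
    if m1 is m2.+1 then path_match m1 + 'X * path_match m2 else 1
  else 1.

Lemma path_matchSS m : path_match m.+2 = path_match m.+1 + 'X * path_match m.
Proof. by []. Qed.

Lemma path_match_nonneg m : nonneg (path_match m).
Proof.
suff: nonneg (path_match m) && nonneg (path_match m.+1) by case/andP.
elim: m => [|m /andP[IH0 IH1]]; first by rewrite !rpred1.
by rewrite IH1 path_matchSS rpredD ?rpredM ?nonnegX.
Qed.

Lemma path_match_leS m : path_match m <=c path_match m.+1.
Proof.
case: m => [|m]; first exact: lecoef_refl.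
by rewrite /lecoef path_matchSS addrC addKr rpredM ?nonnegX ?path_match_nonneg.
Qed.

(** Cut the path at one edge: a matching avoids that edge, or contains it and
    then no edge next to it. *)
Lemma path_matchD m k : path_match (m.+1 + k.+1) =
  path_match m.+1 * path_match k.+1 + 'X * (path_match m * path_match k).
Proof.
pose cut l := path_match (m.+1 + l.+1) =
  path_match m.+1 * path_match l.+1 + 'X * (path_match m * path_match l).
suff: cut k /\ cut k.+1 by case.
elim: k => [|k [IH0 IH1]]; rewrite /cut.
  by rewrite !addnS addn0 !path_matchSS /=; split; ring.
split=> //; rewrite addnS addnS path_matchSS -!addnS IH1 IH0 !path_matchSS; ring.
Qed.

Lemma path_match_mul_le m k :
  path_match m * path_match k <=c path_match (m + k).
Proof.
case: m => [|m]; first by rewrite mul1r lecoef_refl.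
case: k => [|k]; first by rewrite mulr1 addn0 lecoef_refl.
by rewrite path_matchD /lecoef addrC addKr !rpredM ?nonnegX ?path_match_nonneg.
Qed.

(** Both products count the matchings of one path that avoid a given edge, so the
    claim is that fewer matchings use that edge when just two vertices precede
    it than when some other even number does:
    f_1 f_(2m+2k+1) <= f_(2m+1) f_(2k+1). *)
Lemma path_match_unbalance m k :
  path_match m.*2.+2 * path_match k.*2.+2 <=c
  path_match 2 * path_match (m + k).*2.+2.
Proof.
have -> : path_match 2 * path_match (m + k).*2.+2 =
   path_match m.*2.+2 * path_match k.*2.+2 +
   'X * (path_match m.*2.+1 * path_match k.*2.+1 - path_match (m + k).*2.+1).
  (* Both sides become f_(2m+2k+4), cut at two different edges. *)
  apply: (addIr ('X * (path_match 1 * path_match (m + k).*2.+1))).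
  rewrite -path_matchD (_ : (2 + _ = m.*2.+2 + k.*2.+2)%N); last by lia.
  by rewrite path_matchD /=; ring.
rewrite /lecoef addrC addKr rpredM ?nonnegX //.
case: k => [|k]; first by rewrite addn0 mulr1 subrr rpred0.
rewrite (_ : (m + k.+1).*2.+1 = m.*2.+1 + k.*2.+2)%N; last by lia.
rewrite path_matchD doubleS (path_matchSS k.*2.+1).
rewrite (_ : _ - _ = 'X * ((path_match m.*2.+1 - path_match m.*2) * path_match k.*2.+1)).
  by rewrite !rpredM ?nonnegX ?path_match_nonneg //; apply: path_match_leS.
ring.
Qed.

(** * Bounds for rooted trees *)

Lemma rooted_tree_join_polys n (u w : 'I_n) A B L L' d d' :
  rooted_tree u A L d -> rooted_tree w B L' d' -> [disjoint A & B] ->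
  lap_poly (L + L' + edge_mx u w) =
    lap_poly L * (lap_poly L' + 'X * minor_poly w L')
    + 'X * (minor_poly u L * lap_poly L') /\
  minor_poly u (L + L' + edge_mx u w) =
    minor_poly u L * (lap_poly L' + 'X * minor_poly w L').
Proof.
move=> tA tB dAB; have [sA sB] := (rooted_tree_supported tA, rooted_tree_supported tB).
have [uA wB] := (rooted_tree_root tA, rooted_tree_root tB).
rewrite (lap_poly_join sA sB) // (minor_poly_join sA sB) //; split=> //; ring.
Qed.

Lemma rooted_tree_nonneg n (u : 'I_n) A L d : rooted_tree u A L d ->
  nonneg (lap_poly L) /\ nonneg (minor_poly u L).
Proof.
elim=> {u A L d} [u|u A L d w B L' d' tA [a b] tB [a' b'] dAB].
  by rewrite lap_poly0 minor_poly0 !rpred1.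
have [-> ->] := rooted_tree_join_polys tA tB dAB.
by split; rewrite ?rpredD ?rpredM ?rpredD ?rpredM ?nonnegX.
Qed.

(** For paths rooted at an end, joining the roots gives a path of the total length
    rooted inside, whose a is that of the same path rooted at an end; its b is a
    product of two path polynomials, below the corresponding b by
    [path_match_mul_le]. *)
Lemma rooted_tree_le_path n (u : 'I_n) A L d m :
  rooted_tree u A L d -> #|A| = m.+1 ->
  lap_poly L <=c path_match m.*2.+1 /\ minor_poly u L <=c path_match m.*2.
Proof.
move=> tA; elim: tA m => {u A L d} [u|u A L d w B L' d' tA IHA tB IHB dAB] m.
  rewrite cards1 => -[<-]; rewrite lap_poly0 minor_poly0; split; exact: lecoef_refl.
have [[a0 b0] [a0' b0']] := (rooted_tree_nonneg tA, rooted_tree_nonneg tB).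
rewrite cardsU disjoint_setI0 // cards0 subn0 => cardAB.
have [p cardA] : exists p, #|A| = p.+1.
  by exists #|A|.-1; have := rooted_tree_card tA; lia.
have [q cardB] : exists q, #|B| = q.+1.
  by exists #|B|.-1; have := rooted_tree_card tB; lia.
have [[aA bA] [aB bB]] := (IHA _ cardA, IHB _ cardB).
have -> : m = (p + q.+1)%N by lia.
have [-> ->] := rooted_tree_join_polys tA tB dAB.
have e0 : nonneg (lap_poly L' + 'X * minor_poly w L').
  by rewrite rpredD ?rpredM ?nonnegX.
have eB : lap_poly L' + 'X * minor_poly w L' <=c path_match q.*2.+2.
  by rewrite path_matchSS lecoefD // lecoefM ?nonnegX ?lecoef_refl.
split.
  rewrite (_ : (p + q.+1).*2.+1 = p.*2.+1 + q.*2.+2)%N; last by lia.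
  by rewrite path_matchD lecoefD ?lecoefM ?rpredM ?nonnegX ?lecoef_refl.
rewrite (_ : (p + q.+1).*2 = p.*2 + q.*2.+2)%N; last by lia.
by apply: lecoef_trans (path_match_mul_le _ _); rewrite lecoefM.
Qed.

Arguments path_match : simpl never.

(** The pair (a, b) of the star with k leaves rooted at its centre, each step
    grafting a single vertex, whose own pair is (1, 1). *)
Fixpoint star_match k : {poly int} * {poly int} :=
  if k is k'.+1 then
    ((star_match k').1 * path_match 2 + 'X * (star_match k').2,
     (star_match k').2 * path_match 2)
  else (1, 1).

Lemma star_match_nonneg k :
  nonneg (star_match k).2 /\ (star_match k).2 <=c (star_match k).1.
Proof.
elim: k => [|k [b0 ab]] /=; first by rewrite rpred1 lecoef_refl.
have f2 := path_match_nonneg 2.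
split; first by rewrite rpredM.
rewrite -[X in X <=c _]addr0; apply: lecoefD; first by rewrite lecoefM ?lecoef_refl.
by rewrite /lecoef subr0 rpredM ?nonnegX.
Qed.

(** The pair (a, b) of the star with k leaves and one more branch, a path on m + 1
    vertices, rooted at its centre. *)
Definition broom_match k m : {poly int} * {poly int} :=
  ((star_match k).1 * path_match m.*2.+2 + 'X * ((star_match k).2 * path_match m.*2.+1),
   (star_match k).2 * path_match m.*2.+2).

(** The left sides are the pair of the centre with k leaves and two path branches
    on m + 1 and q + 1 vertices; on the right the second branch has given all
    its vertices but one to the first.  Let (a, b) be the pair of the star with k
    leaves and let F count the matchings of the subdivided path branches, each
    with the subdivision vertex of its edge to the centre (on the right: F').
    Then the first entry is a F + b (P - F), where P counts the matchings of the
    subdivided path through the centre and depends only on its length ([total]).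
    So the change is (a - b) (F' - F), and F <= F' is [path_match_unbalance]. *)
Lemma broom_match_shift k m q :
  (broom_match k m).1 * path_match q.*2.+2
    + 'X * ((broom_match k m).2 * path_match q.*2.+1) <=c (broom_match k.+1 (m + q)).1 /\
  (broom_match k m).2 * path_match q.*2.+2 <=c (broom_match k.+1 (m + q)).2.
Proof.
have [b0 ab] := star_match_nonneg k; have spread := path_match_unbalance m q.
rewrite /broom_match /=; set f2 := path_match 2 in spread *.
set a := (star_match k).1; set b := (star_match k).2.
set F := path_match _ * path_match _ in spread.
split; last by rewrite -!mulrA lecoefM ?lecoef_refl // rpredM ?path_match_nonneg.
have total : F + 'X * (path_match m.*2.+1 * path_match q.*2.+2)
     + 'X * (path_match m.*2.+2 * path_match q.*2.+1) =
   f2 * path_match (m + q).*2.+2 + 'X * path_match (m + q).*2.+2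
     + 'X * (f2 * path_match (m + q).*2.+1).
  have E1 : path_match (m.*2.+3 + q.*2.+2) =
     F + 'X * (path_match m.*2.+1 * path_match q.*2.+2)
     + 'X * (path_match m.*2.+2 * path_match q.*2.+1).
    by rewrite path_matchD (path_matchSS m.*2.+1) /F; ring.
  have E2 : path_match (3 + (m + q).*2.+2) =
     f2 * path_match (m + q).*2.+2 + 'X * path_match (m + q).*2.+2
     + 'X * (f2 * path_match (m + q).*2.+1).
    by rewrite path_matchD (path_matchSS 1) -/f2 [path_match 1]/=; ring.
  by rewrite -E1 -E2; congr path_match; lia.
rewrite /lecoef (_ : _ - _ = (a - b) * (f2 * path_match (m + q).*2.+2 - F)).
  by rewrite rpredM.
(* The two entries differ by this product and b times the difference of the
   two sides of [total]. *)
transitivity ((a - b) * (f2 * path_match (m + q).*2.+2 - F)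
  + b * (f2 * path_match (m + q).*2.+2 + 'X * path_match (m + q).*2.+2
         + 'X * (f2 * path_match (m + q).*2.+1)
         - (F + 'X * (path_match m.*2.+1 * path_match q.*2.+2)
            + 'X * (path_match m.*2.+2 * path_match q.*2.+1)))).
  by rewrite /F; ring.
by rewrite total subrr; ring.
Qed.

Lemma rooted_tree_deg0 n (u : 'I_n) A L d :
  rooted_tree u A L d -> d = 0%N -> L = 0 /\ #|A| = 1%N.
Proof. by case=> // v _; rewrite cards1. Qed.

(** The only branch of a root of degree one is below a path.  Otherwise,
    by induction, the tree without its last branch is below a broom, and the last
    branch is below a path, so the whole is below a broom with one more path
    branch, to which [broom_match_shift] applies. *)
Lemma rooted_tree_le_broom n (u : 'I_n) A L d k m :
  rooted_tree u A L d -> d = k.+1 -> #|A| = (k.+2 + m)%N ->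
  lap_poly L <=c (broom_match k m).1 /\ minor_poly u L <=c (broom_match k m).2.
Proof.
move=> tA; elim: tA k m => {u A L d} [//|u A L d w B L' d' tA IHA tB _ dAB] k m [eq_dk].
have [[a0 b0] [a0' b0']] := (rooted_tree_nonneg tA, rooted_tree_nonneg tB).
rewrite cardsU disjoint_setI0 // cards0 subn0 => cardAB.
have := rooted_tree_card tA; rewrite eq_dk => ltA.
have [q cardB] : exists q, #|B| = q.+1.
  by exists #|B|.-1; have := rooted_tree_card tB; lia.
have [aB bB] := rooted_tree_le_path tB cardB.
have [-> ->] := rooted_tree_join_polys tA tB dAB.
have e0 : nonneg (lap_poly L' + 'X * minor_poly w L').
  by rewrite rpredD ?rpredM ?nonnegX.
have eB : lap_poly L' + 'X * minor_poly w L' <=c path_match q.*2.+2.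
  by rewrite path_matchSS lecoefD // lecoefM ?nonnegX ?lecoef_refl.
case: k => [|k] in eq_dk ltA cardAB *.
  have [L0 cardA] := rooted_tree_deg0 tA eq_dk.
  have -> : m = q by lia.
  rewrite /broom_match /= L0 lap_poly0 minor_poly0 !mul1r.
  by rewrite lecoefD ?lecoefM ?nonnegX ?lecoef_refl.
have [p cardA] : exists p, #|A| = (k.+2 + p)%N by exists (#|A| - k.+2)%N; lia.
have [aA bA] := IHA _ _ eq_dk cardA.
have -> : m = (p + q)%N by lia.
have [broomA broomB] := broom_match_shift k p q.
split.
  apply: lecoef_trans broomA.
  by rewrite lecoefD ?lecoefM ?rpredM ?nonnegX ?lecoef_refl.
by apply: lecoef_trans broomB; rewrite lecoefM.
Qed.

(** * The polynomial of the broom *)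

Lemma induced_lap_join_polys n (T : sgraph 'I_n) (A B : {set 'I_n}) u w :
  [disjoint A & B] -> u \in A -> w \in B ->
  {in A & B, forall x y, adj T x y = (x == u) && (y == w)} ->
  let e := lap_poly (induced_lap T B) + 'X * minor_poly w (induced_lap T B) in
  lap_poly (induced_lap T (A :|: B)) = lap_poly (induced_lap T A) * e
     + 'X * (minor_poly u (induced_lap T A) * lap_poly (induced_lap T B)) /\
  minor_poly u (induced_lap T (A :|: B)) = minor_poly u (induced_lap T A) * e.
Proof.
move=> dAB uA wB cross e.
have sA := @induced_lap_supported _ T A.
have sB := @induced_lap_supported _ T B.
rewrite (induced_lap_join dAB uA wB cross).
rewrite (lap_poly_join sA sB) // (minor_poly_join sA sB) //.
by split=> //; rewrite /e; ring.
Qed.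

Lemma broom_path_polys n D m (i : 'I_n) : (D <= i)%N -> (i + m.+1)%N = n ->
  lap_poly (induced_lap (broom n D) [set j : 'I_n | i <= j]%N) = path_match m.*2.+1 /\
  minor_poly i (induced_lap (broom n D) [set j : 'I_n | i <= j]%N) = path_match m.*2.
Proof.
elim: m i => [|m IHm] i leDi eq_n.
  rewrite (_ : [set j : 'I_n | i <= j]%N = [set i]).
    by rewrite induced_lap1 lap_poly0 minor_poly0.
  apply/setP=> j; rewrite !inE -val_eqE /=; have := ltn_ord j; lia.
have lt_in : (i.+1 < n)%N by lia.
pose i1 := Ordinal lt_in.
have [|| a1 b1] := IHm i1; [by rewrite /= leqW | by rewrite addSnnS |].
rewrite (_ : [set j : 'I_n | i <= j]%N =
  [set i] :|: [set j : 'I_n | i1 <= j]%N); last first.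
  by apply/setP=> j; rewrite !inE -val_eqE /=; lia.
have [|||| -> ->] := @induced_lap_join_polys _ (broom n D)
  [set i] [set j : 'I_n | i1 <= j]%N i i1.
- by rewrite disjoints1 inE /= ltnn.
- exact: set11.
- by rewrite inE.
- move=> x y /set1P->; rewrite inE -!val_eqE /= /broom_adj /broom_arc /=; lia.
rewrite a1 b1 induced_lap1 lap_poly0 minor_poly0 doubleS !path_matchSS; split; ring.
Qed.

Lemma broom_star_polys n D m (o : 'I_n) :
  o = 0%N :> nat -> (m < D)%N -> (m < n)%N ->
  lap_poly (induced_lap (broom n D) [set j : 'I_n | j <= m]%N) = (star_match m).1 /\
  minor_poly o (induced_lap (broom n D) [set j : 'I_n | j <= m]%N) = (star_match m).2.
Proof.
move=> o0; elim: m => [|m IHm] lt_mD lt_mn.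
  rewrite (_ : [set j : 'I_n | j <= 0]%N = [set o]).
    by rewrite induced_lap1 lap_poly0 minor_poly0.
  apply/setP=> j; rewrite !inE -val_eqE /=; lia.
have [a1 b1] := IHm (ltnW lt_mD) (ltnW lt_mn).
pose w := Ordinal lt_mn.
rewrite (_ : [set j : 'I_n | j <= m.+1]%N =
  [set j : 'I_n | j <= m]%N :|: [set w]); last first.
  by apply/setP=> j; rewrite !inE -val_eqE /=; lia.
have [|||| -> ->] := @induced_lap_join_polys _ (broom n D)
  [set j : 'I_n | j <= m]%N [set w] o w.
- by rewrite disjoint_sym disjoints1 inE /= ltnn.
- by rewrite inE o0.
- exact: set11.
- move=> x y; rewrite inE => xm /set1P->.
  by rewrite -!val_eqE /= /broom_adj /broom_arc /=; lia.
rewrite a1 b1 induced_lap1 lap_poly0 minor_poly0 /= path_matchSS.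
by split; rewrite /path_match; ring.
Qed.

Lemma broom_lap_poly k m :
  lap_poly (laplacian (broom (k.+2 + m) k.+1)) = (broom_match k m).1.
Proof.
set n := (k.+2 + m)%N; set D := k.+1.
have lt0n : (0 < n)%N by []. have ltDn : (D < n)%N by rewrite /n /D; lia.
pose o := Ordinal lt0n; pose w := Ordinal ltDn.
have [|| a b] := @broom_path_polys n D m w; [by [] | by rewrite /n /D /=; lia |].
have [|||a' b'] := @broom_star_polys n D k o; rewrite ?leqnn //; first by apply: ltnW.
rewrite -induced_lapT (_ : setT =
  [set j : 'I_n | j <= k]%N :|: [set j : 'I_n | w <= j]%N); last first.
  by apply/setP=> j; rewrite !inE /= /D; lia.
have [|||| -> _] := @induced_lap_join_polys _ (broom n D)
  [set j : 'I_n | j <= k]%N [set j : 'I_n | w <= j]%N o w.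
- rewrite -setI_eq0; apply/eqP/setP=> j; rewrite !inE /= /D; lia.
- by rewrite inE.
- by rewrite inE.
- by move=> x y; rewrite !inE -!val_eqE /= /broom_adj /broom_arc /D /=; lia.
by rewrite a b a' b' -path_matchSS.
Qed.

Lemma laplacian_diag n (T : sgraph 'I_n) v : laplacian T v v = (deg T v)%:R.
Proof. by rewrite !mxE eqxx mulr1n adj_irr subr0. Qed.

Theorem corollary10 (n Delta : nat) (T : sgraph 'I_n)
    (T_tree : is_tree T) (T_max_degree : max_degree T = Delta)
    (T_not_broom : ~ isomorphic T (broom n Delta))
    (k : nat) (k_le_n : (k <= n)%N) :
  laplacian_coef T k <= laplacian_coef (broom n Delta) k.
Proof.
rewrite !laplacian_coefE //.
have [v max_v] := bigop.eq_bigmax (deg T) (proj1 (proj1 T_tree)).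
have [d tT] := tree_is_rooted v T_tree.
have eq_d : d = Delta.
  apply/eqP; rewrite -T_max_degree /max_degree max_v -(eqr_nat int) -laplacian_diag.
  by rewrite (rooted_tree_deg tT).
case: Delta => [|D] in eq_d {T_max_degree T_not_broom} *.
  have [-> cardT] := rooted_tree_deg0 tT eq_d.
  have {cardT} setT1 : setT = [set v].
    by apply/esym/eqP; rewrite eqEcard subsetT cardT cards1.
  by rewrite -induced_lapT setT1 induced_lap1.
have := rooted_tree_card tT; rewrite cardsT card_ord eq_d => lt_Dn.
have [m eq_n] : exists m, n = (D.+2 + m)%N by exists (n - D.+2)%N; lia.
move: eq_n T T_tree v max_v tT k_le_n lt_Dn => -> T T_tree v max_v tT _ _.
apply: lecoefP; rewrite broom_lap_poly.
by have [] := @rooted_tree_le_broom _ _ _ _ _ _ m tT eq_d; rewrite // cardsT card_ord.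
Qed.
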